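(* Let $R$ be a commutative unital ring, $\Gamma$ a discrete abelian group, $\mathcal G$ a $\Gamma$-graded ample groupoid and $x\in\mathcal G^{(0)}$. If $M$ is a graded $A_R(\mathcal G)$-module, then $\mathrm{Res}_x(M)$ is a graded $R\mathcal G_x$-module. Moreover, $\mathrm{Res}_x$ is a functor from the category of graded $A_R(\mathcal G)$-modules to the category of graded $R\mathcal G_x$-modules (with graded homomorphisms).
   Context: Groupoids. For a groupoid $\mathcal G$ with unit space $\mathcal G^{(0)}$, $d(g)=g^{-1}g$, $c(g)=gg^{-1}$, and $gh$ is defined iff $d(g)=c(h)$. For $x\in\mathcal G^{(0)}$, $\mathcal G_x=\{g: d(g)=c(g)=x\}$ is the isotropy group. An open bisection is an open $U\subseteq\mathcal G$ such that $d|_U$, $c|_U$ are homeomorphisms onto open subsets of $\mathcal G^{(0)}$. A topological groupoid $\mathcal G$ is ample if $d$ is a local homeomorphism, $\mathcal G^{(0)}$ is Hausdorff, and compact open bisections form a basis of the topology. $\mathcal G$ is $\Gamma$-graded if there is a continuous $\kappa:\mathcal G\to\Gamma$ with $\kappa(gh)=\kappa(g)\kappa(h)$ for composable $g,h$; $\mathcal G_\gamma=\kappa^{-1}(\gamma)$. $A_R(\mathcal G)$ (Steinberg algebra) is the $R$-span in $R^{\mathcal G}$ of characteristic functions $\mathbf 1_U$ of compact open bisections, with product $f*g(x)=\sum_{d(y)=d(x)}f(xy^{-1})g(y)$; it is $\Gamma$-graded with $A_R(\mathcal G)_\gamma$ spanned by the $\mathbf 1_U$ with $U\subseteq\mathcal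 G_\gamma$. $R\mathcal G_x$ is $\Gamma$-graded with $\gamma$-component having basis $\mathcal G_x\cap\mathcal G_\gamma$. Modules are left and unital ($AM=M$); a graded module is $M=\bigoplus_\gamma M_\gamma$ with $A_\delta M_\gamma\subseteq M_{\delta\gamma}$; graded homomorphisms preserve degrees. For an $A_R(\mathcal G)$-module $M$, $\mathrm{Res}_x(M)=\bigcap_U\mathbf 1_UM$, where $U$ ranges over the compact open subsets of $\mathcal G^{(0)}$ containing $x$; it is an $R\mathcal G_x$-module via $tw=\mathbf 1_Vw$ for $t\in\mathcal G_x$, $w\in\mathrm{Res}_x(M)$, where $V$ is any compact open bisection containing $t$. For $M$ graded, the grading on $\mathrm{Res}_x(M)$ is $\mathrm{Res}_x(M)_\gamma=\mathrm{Res}_x(M)\cap M_\gamma$; on homomorphisms $\mathrm{Res}_x$ is restriction. *)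

(* Defs.v *)
From HB Require Import structures.
From mathcomp Require Import all_boot all_algebra.
From mathcomp Require Import boolp classical_sets functions cardinality fsbigop.
From mathcomp Require Import topology.

Set Implicit Arguments.
Unset Strict Implicit.
Unset Printing Implicit Defensive.

Import GRing.Theory.

Local Open Scope classical_set_scope.
Local Open Scope ring_scope.

Record category := Category {
  ob :> Type;
  hom : ob -> ob -> Type;
  idc : forall a, hom a a;
  compc : forall a b c, hom b c -> hom a b -> hom a c;
  compc1 : forall a b (f : hom a b), compc f (idc a) = f;
  comp1c : forall a b (f : hom a b), compc (idc b) f = f;
  compcA : forall a b c d (h : hom c d) (g : hom b c) (f : hom a b),
    compc h (compc g f) = compc (compc h g) f }.

Record functor_on (C D : category) (F : C -> D) := FunctorOn {
  functor_map : forall a b : C, hom a b -> hom (F a) (F b);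
  functor_id : forall a : C, functor_map (idc a) = idc (F a);
  functor_comp : forall (a b c : C) (g : hom b c) (f : hom a b),
    functor_map (compc g f) = compc (functor_map g) (functor_map f) }.

Definition is_subgroup (V : zmodType) (S : set V) : Prop :=
  S 0 /\ forall v w, S v -> S w -> S (v - w).

Section SubgroupZmod.
Variables (V : zmodType) (S : set V) (hS : is_subgroup S).

Definition subgroup_of of is_subgroup S : Type := {v : V | v \in S}.
Local Notation W := (subgroup_of hS).

HB.instance Definition _ := Choice.on W.

Let mk (v : V) (h : S v) : W := exist _ v (mem_set h).

Fact subgroup_zeroP : S 0. Proof. by case: hS. Qed.
Fact subgroup_oppP (v : W) : S (- sval v).
Proof.
by case: hS => h0 hB; rewrite -sub0r; apply: hB => //; apply: set_mem (svalP v).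
Qed.
Fact subgroup_addP (v w : W) : S (sval v + sval w).
Proof.
rewrite -[sval w]opprK; case: hS => h0 hB; apply: hB; first exact: set_mem (svalP v).
exact: subgroup_oppP.
Qed.

Let zero : W := mk subgroup_zeroP.
Let opp (v : W) : W := mk (subgroup_oppP v).
Let add (v w : W) : W := mk (subgroup_addP v w).

Let addA : associative add.
Proof. by move=> u v w; apply: val_inj; rewrite /= addrA. Qed.
Let addC : commutative add.
Proof. by move=> u v; apply: val_inj; rewrite /= addrC. Qed.
Let add0 : left_id zero add.
Proof. by move=> u; apply: val_inj; rewrite /= add0r. Qed.
Let addN : left_inverse zero opp add.
Proof. by move=> u; apply: val_inj; rewrite /= addNr. Qed.

HB.instance Definition _ := GRing.isZmodule.Build W addA addC add0 addN.

Definition sub_val (w : W) : V := sval w.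

Lemma sub_valP (w : W) : S (sub_val w). Proof. exact: set_mem (svalP w). Qed.
Lemma sub_val_inj : injective sub_val. Proof. exact: val_inj. Qed.
Lemma sub_valD (v w : W) : sub_val (v + w) = sub_val v + sub_val w.
Proof. by []. Qed.
Lemma sub_val0 : sub_val 0 = 0. Proof. by []. Qed.
Lemma sub_valN (v : W) : sub_val (- v) = - sub_val v. Proof. by []. Qed.

Definition sub_mk (v : V) (h : S v) : W := mk h.
Lemma sub_mkK (v : V) (h : S v) : sub_val (sub_mk h) = v. Proof. by []. Qed.

End SubgroupZmod.

(* V is the internal direct sum of the subgroups comp gamma *)
Definition is_grading (Gam V : zmodType) (comp : Gam -> set V) : Prop :=
  (forall gam, is_subgroup (comp gam)) /\
  forall v : V, exists! p : Gam -> V,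
    [/\ finite_set [set gam | p gam != 0],
        forall gam, comp gam (p gam) &
        v = \sum_(gam \in [set: Gam]) p gam].

Record gradedRing (Gam : zmodType) := GradedRing {
  ring_sort :> zmodType;
  rmul : ring_sort -> ring_sort -> ring_sort;
  rcomp : Gam -> set ring_sort;
  rmulA : associative rmul;
  rmulDl : left_distributive rmul +%R;
  rmulDr : right_distributive rmul +%R;
  rcomp_grading : is_grading rcomp;
  rcompM : forall del gam a b,
    rcomp del a -> rcomp gam b -> rcomp (del + gam) (rmul a b) }.

(* Modules are abelian groups. Over the rings used below, where A V = V and A has
   local units e, the scalars act on V through r (e v) = (r e) v. *)
Record gmodule (Gam : zmodType) (A : gradedRing Gam) (V : zmodType) := GModule {
  act : A -> V -> V;
  mcomp : Gam -> set V;
  actDl : forall a b v, act (a + b) v = act a v + act b v;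
  actDr : forall a v w, act a (v + w) = act a v + act a w;
  actA : forall a b v, act (rmul a b) v = act a (act b v);
  act_unital : forall v, exists (n : nat) (a : 'I_n -> A) (w : 'I_n -> V),
    v = \sum_i act (a i) (w i);
  mcomp_grading : is_grading mcomp;
  act_mcomp : forall del gam a v,
    rcomp del a -> mcomp gam v -> mcomp (del + gam) (act a v) }.

Record gradedModule (Gam : zmodType) (A : gradedRing Gam) := GradedModule {
  mod_sort :> zmodType;
  mod_struct :> gmodule A mod_sort }.

Record gradedHom (Gam : zmodType) (A : gradedRing Gam)
    (M N : gradedModule A) := GradedHom {
  ghom_fun :> M -> N;
  ghomD : forall v w, ghom_fun (v + w) = ghom_fun v + ghom_fun w;
  ghomZ : forall a v, ghom_fun (act M a v) = act N a (ghom_fun v);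
  ghom_mcomp : forall gam v, mcomp M gam v -> mcomp N gam (ghom_fun v) }.

Section GradedModuleCategory.
Variables (Gam : zmodType) (A : gradedRing Gam).
Implicit Types M N P Q : gradedModule A.

Lemma gradedHom_eq M N (f g : gradedHom M N) : f =1 g -> f = g.
Proof.
case: f => f f1 f2 f3; case: g => g g1 g2 g3 /= /funext fg.
by rewrite {}fg in f1 f2 f3 *; congr GradedHom; apply: Prop_irrelevance.
Qed.

Definition ghom_id M : gradedHom M M :=
  @GradedHom _ _ M M id (fun _ _ => erefl) (fun _ _ => erefl) (fun _ _ h => h).

Program Definition ghom_comp M N P (g : gradedHom N P) (f : gradedHom M N) :
  gradedHom M P := @GradedHom _ _ M P (g \o f) _ _ _.
Next Obligation. by move=> M N P g f v w /=; rewrite !ghomD. Qed.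
Next Obligation. by move=> M N P g f a v /=; rewrite !ghomZ. Qed.
Next Obligation. by move=> M N P g f gam v h /=; do 2!apply: ghom_mcomp. Qed.

Program Definition gradedModuleCat : category :=
  @Category (gradedModule A) (@gradedHom Gam A) ghom_id ghom_comp _ _ _.
Next Obligation. by move=> M N f; apply: gradedHom_eq. Qed.
Next Obligation. by move=> M N f; apply: gradedHom_eq. Qed.
Next Obligation. by move=> M N P Q h g f; apply: gradedHom_eq. Qed.

End GradedModuleCategory.

(* A groupoid is given by its set T of arrows. The product is a total function
   whose values are meaningful only on the pairs (g, h) with d g = c h. *)
Definition dom_of (T : Type) (mul : T -> T -> T) (inv : T -> T) (g : T) : T :=
  mul (inv g) g.
Definition cod_of (T : Type) (mul : T -> T -> T) (inv : T -> T) (g : T) : T :=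
  mul g (inv g).

Record groupoid (T : Type) := Groupoid {
  gmul : T -> T -> T;
  ginv : T -> T;
  ginvK : involutive ginv;
  dom_mul : forall g h, dom_of gmul ginv g = cod_of gmul ginv h ->
    dom_of gmul ginv (gmul g h) = dom_of gmul ginv h;
  cod_mul : forall g h, dom_of gmul ginv g = cod_of gmul ginv h ->
    cod_of gmul ginv (gmul g h) = cod_of gmul ginv g;
  gmulA : forall g h k, dom_of gmul ginv g = cod_of gmul ginv h ->
    dom_of gmul ginv h = cod_of gmul ginv k ->
    gmul g (gmul h k) = gmul (gmul g h) k;
  gmul_dom : forall g, gmul g (dom_of gmul ginv g) = g;
  gmul_cod : forall g, gmul (cod_of gmul ginv g) g = g }.

Section Groupoid.
Variables (T : Type) (G : groupoid T).
Implicit Types g h k : T.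

Definition dom g := dom_of (gmul G) (ginv G) g.
Definition cod g := cod_of (gmul G) (ginv G) g.
Definition units : set T := [set g | dom g = g].
Definition isotropy (x : T) : set T := [set g | dom g = x /\ cod g = x].
Definition composable : set (T * T) := [set p | dom p.1 = cod p.2].
Definition set_mul (U V : set T) : set T :=
  [set k | exists g h, [/\ U g, V h, dom g = cod h & k = gmul G g h]].

Local Notation "g ** h" := (gmul G g h) (at level 40, left associativity).
Local Notation "g ^v" := (ginv G g) (at level 2, format "g ^v").

Lemma domV g : dom g^v = cod g. Proof. by rewrite /dom /dom_of ginvK. Qed.
Lemma codV g : cod g^v = dom g. Proof. by rewrite /cod /cod_of ginvK. Qed.
Lemma domM g h : dom g = cod h -> dom (g ** h) = dom h.
Proof. exact: dom_mul. Qed.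
Lemma codM g h : dom g = cod h -> cod (g ** h) = cod g.
Proof. exact: cod_mul. Qed.
Lemma mulgA g h k : dom g = cod h -> dom h = cod k ->
  g ** (h ** k) = g ** h ** k.
Proof. exact: gmulA. Qed.
Lemma mulgd g : g ** dom g = g. Proof. exact: gmul_dom. Qed.
Lemma mulcg g : cod g ** g = g. Proof. exact: gmul_cod. Qed.
Lemma mulgV g : g ** g^v = cod g. Proof. by []. Qed.
Lemma mulVg g : g^v ** g = dom g. Proof. by []. Qed.
Lemma dom_dom g : dom (dom g) = dom g.
Proof. by rewrite -{1}(mulVg g) domM // domV. Qed.
Lemma cod_dom g : cod (dom g) = dom g.
Proof. by rewrite -{1}(mulVg g) codM ?domV // codV. Qed.
Lemma dom_cod g : dom (cod g) = cod g.
Proof. by rewrite -(domV g) dom_dom. Qed.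
Lemma cod_cod g : cod (cod g) = cod g.
Proof. by rewrite -(domV g) cod_dom. Qed.
Lemma units_dom g : units (dom g). Proof. exact: dom_dom. Qed.
Lemma units_cod g : units (cod g). Proof. exact: dom_cod. Qed.
Lemma unit_cod g : units g -> cod g = g. Proof. by move=> <-; rewrite cod_dom. Qed.
Lemma mulgK g h : dom g = cod h -> g ** h ** h^v = g.
Proof. by move=> e; rewrite -mulgA ?codV // mulgV -e mulgd. Qed.
Lemma mulgVK g h : dom g = dom h -> g ** h^v ** h = g.
Proof. by move=> e; rewrite -mulgA ?codV ?domV // mulVg -e mulgd. Qed.
Lemma domMV g h : dom g = dom h -> dom (g ** h^v) = cod h.
Proof. by move=> e; rewrite domM ?domV // codV. Qed.

End Groupoid.

Definition homeo_onto (X Y : topologicalType) (U : set X) (f : X -> Y)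
    (V : set Y) : Prop :=
  [/\ set_bij U V f, {within U, continuous f} &
    exists2 h : Y -> X, (forall x, U x -> h (f x) = x) &
                        {within V, continuous h}].

Section TopologicalGroupoid.
Variables (T : topologicalType) (G : groupoid T).

Definition homeo_open_units (U : set T) (f : T -> T) : Prop :=
  exists V : set T,
    [/\ V `<=` units G, open (V : set (subspace (units G))) &
        homeo_onto U f V].

Definition open_bisection (U : set T) : Prop :=
  [/\ open U, homeo_open_units U (dom G) & homeo_open_units U (cod G)].

Definition compact_open_bisection (U : set T) : Prop :=
  compact U /\ open_bisection U.

Definition compact_open_units (U : set T) : Prop :=
  [/\ U `<=` units G, compact U & open (U : set (subspace (units G)))].

Definition topological_groupoid : Prop :=
  continuous (ginv G) /\
  {within composable G, continuous (fun p => gmul G p.1 p.2)}.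

Definition ample : Prop :=
  [/\ forall g, exists U : set T,
        [/\ open U, U g & homeo_open_units U (dom G)],
      hausdorff_space (set_type (units G)) &
      forall (W : set T) g, open W -> W g ->
        exists U, [/\ compact_open_bisection U, U g & U `<=` W]].

End TopologicalGroupoid.

Record gradedAmpleGroupoid (Gam : zmodType) := GradedAmpleGroupoid {
  arrows :> topologicalType;
  arrows_groupoid :> groupoid arrows;
  arrows_top : topological_groupoid arrows_groupoid;
  arrows_ample : ample arrows_groupoid;
  deg : arrows -> Gam;
  deg_continuous : continuous (deg : arrows -> discrete_topology Gam);
  degM : forall g h, dom arrows_groupoid g = cod arrows_groupoid h ->
    deg (gmul arrows_groupoid g h) = deg g + deg h }.
Arguments deg {Gam} _ _.

Section Convolution.
Variables (T : choiceType) (G : groupoid T) (R : comPzRingType).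
Implicit Types (f g h : T -> R) (r s : R) (U V W : set T) (B : set (set T)).

(* r times the characteristic function of U *)
Definition cind r U : T -> R := fun x => if x \in U then r else 0.

Definition span B : set (T -> R) := [set f |
  exists (n : nat) (r : 'I_n -> R) (U : 'I_n -> set T),
    (forall i, B (U i)) /\ f = \sum_i cind (r i) (U i)].

Definition conv f g : T -> R := fun x =>
  \sum_(y \in [set y | dom G y = dom G x]) f (gmul G x (ginv G y)) * g y.

Lemma cindT r U x : U x -> cind r U x = r.
Proof. by move=> Ux; rewrite /cind mem_set. Qed.
Lemma cindF r U x : ~ U x -> cind r U x = 0.
Proof. by move=> Ux; rewrite /cind memNset. Qed.
Lemma cindN r U : - cind r U = cind (- r) U.
Proof.
by apply/funext => x; rewrite opprfctE /cind; case: ifP => // _; rewrite oppr0.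
Qed.
Lemma cindD r s U : cind (r + s) U = cind r U + cind s U.
Proof.
by apply/funext => x; rewrite addrfctE /cind; case: ifP => // _; rewrite addr0.
Qed.
Lemma cind0 r : cind r set0 = 0.
Proof. by apply/funext => x; rewrite cindF. Qed.

Lemma span_cind B r U : B U -> span B (cind r U).
Proof. by move=> BU; exists 1%N, (fun=> r), (fun=> U); split => //; rewrite big_ord1. Qed.

Lemma span0 B : span B 0.
Proof.
by exists 0%N, (fun=> 0), (fun=> set0); split; [case | rewrite big_ord0].
Qed.

Lemma spanN B f : span B f -> span B (- f).
Proof.
move=> [n [r [U [BU ->]]]]; exists n, (fun i => - r i), U; split => //.
by rewrite -sumrN; apply: eq_bigr => i _; rewrite cindN.
Qed.

Lemma spanD B f g : span B f -> span B g -> span B (f + g).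
Proof.
move=> [n [r [U [BU ->]]]] [m [s [V [BV ->]]]].
exists (n + m)%N.
exists (fun i => match fintype.split i with inl j => r j | inr j => s j end).
exists (fun i => match fintype.split i with inl j => U j | inr j => V j end).
split; first by move=> i; case: (fintype.split i).
rewrite big_split_ord /=; congr (_ + _); apply: eq_bigr => i _.
  by rewrite (unsplitK (inl i)).
by rewrite (unsplitK (inr i)).
Qed.

Lemma span_subgroup B : is_subgroup (span B).
Proof. by split=> [|f g hf hg]; [apply: span0 | apply: spanD => //; apply: spanN]. Qed.

Lemma span_ind B (P : (T -> R) -> Prop) :
    P 0 -> (forall f g, span B f -> span B g -> P f -> P g -> P (f + g)) ->
    (forall r U, B U -> P (cind r U)) ->
  forall f, span B f -> P f.
Proof.
move=> P0 PD Pc f [n [r [U [BU ->]]]].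
suff [] : span B (\sum_i cind (r i) (U i)) /\ P (\sum_i cind (r i) (U i)) by [].
elim/big_ind: _ => [|f1 f2 [s1 p1] [s2 p2]|i _].
- by split => //; apply: span0.
- by split; [apply: spanD | apply: PD].
- by split; [apply: span_cind | apply: Pc].
Qed.

Lemma span_sub B B' : B `<=` B' -> span B `<=` span B'.
Proof.
move=> BB' f [n [r [U [BU ->]]]]; exists n, r, U; split => // i.
exact: BB'.
Qed.

Lemma conv_fin f g x (S : set T) :
    (forall y, S y -> dom G y = dom G x) ->
    (forall y, dom G y = dom G x -> ~ S y -> g y = 0) ->
  conv f g x = \sum_(y \in S) f (gmul G x (ginv G y)) * g y.
Proof.
move=> Sd Sg; rewrite /conv; symmetry; apply: fsbig_widen => // y [/= yx Sy].
by rewrite (Sg y) // mulr0.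
Qed.

Definition fib_finite g : Prop :=
  forall x, finite_set [set y | dom G y = dom G x /\ g y != 0].

Lemma conv_fib f g x :
  conv f g x = \sum_(y \in [set y | dom G y = dom G x /\ g y != 0])
                 f (gmul G x (ginv G y)) * g y.
Proof.
apply: conv_fin => [y [] //|y yx ny]; apply/eqP; apply: contrapT => /negP gy.
by apply: ny.
Qed.

Lemma fib_finiteD g h : fib_finite g -> fib_finite h -> fib_finite (g + h).
Proof.
move=> fg fh x; apply: (@sub_finite_set _ _
  ([set y | dom G y = dom G x /\ g y != 0] `|`
   [set y | dom G y = dom G x /\ h y != 0])); last by rewrite finite_setU.
move=> y /= [yx ny]; case: (eqVneq (g y) 0) => [g0|]; last by left.
right; split => //; apply: contra ny => /eqP h0.
by change (g y + h y == 0); rewrite g0 h0 addr0.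
Qed.

Lemma convDl f g h : fib_finite h -> conv (f + g) h = conv f h + conv g h.
Proof.
move=> fh; apply/funext => x; change (conv (f + g) h x = conv f h x + conv g h x).
by rewrite !conv_fib -fsbig_split //=; apply: eq_fsbigr => y _; rewrite -mulrDl.
Qed.

Lemma convDr f g h : fib_finite g -> fib_finite h ->
  conv f (g + h) = conv f g + conv f h.
Proof.
move=> fg fh; apply/funext => x; change (conv f (g + h) x = conv f g x + conv f h x).
pose S := [set y | dom G y = dom G x /\ g y != 0] `|`
          [set y | dom G y = dom G x /\ h y != 0].
have Sd y : S y -> dom G y = dom G x by move=> [] [].
have fS : finite_set S by rewrite finite_setU.
have S0 y : dom G y = dom G x -> ~ S y -> g y = 0 /\ h y = 0.
  move=> yx nS; split; apply/eqP; apply: contrapT => /negP n0; apply: nS.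
    by left.
  by right.
rewrite !(@conv_fin _ _ x S) //.
- by rewrite -fsbig_split //=; apply: eq_fsbigr => y _; rewrite -mulrDr.
- by move=> y yx /S0 [].
- by move=> y yx /S0 [].
- move=> y yx /S0 [] // g0 h0; change (g y + h y = 0).
  by rewrite g0 h0 addr0.
Qed.

Lemma conv0r f : conv f 0 = 0.
Proof.
by apply/funext => x; apply: fsbig1 => y _; rewrite [(0 : T -> R) y]/0 mulr0.
Qed.

Lemma conv0l f : conv 0 f = 0.
Proof. by apply/funext => x; apply: fsbig1 => y _; rewrite mul0r. Qed.

Lemma conv_cindr f s V x y : set_inj V (dom G) -> V y -> dom G y = dom G x ->
  conv f (cind s V) x = f (gmul G x (ginv G y)) * s.
Proof.
move=> Vi Vy yx; rewrite (@conv_fin _ _ _ [set y]).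
- by rewrite fsbig_set1 cindT.
- by move=> z ->.
- move=> z zx zy; apply: cindF => Vz; apply: zy; apply: Vi; rewrite ?inE //.
  by rewrite zx.
Qed.

Lemma conv_cindr0 f s V x : (forall y, V y -> dom G y <> dom G x) ->
  conv f (cind s V) x = 0.
Proof.
move=> Vx; apply: fsbig1 => y /= yx.
by rewrite cindF ?mulr0 // => /Vx.
Qed.

Lemma fib_finite_cind r U : set_inj U (dom G) -> fib_finite (cind r U).
Proof.
move=> Ui x.
have [[y Uy yx]|nU] := pselect (exists2 y, U y & dom G y = dom G x).
  apply: (@sub_finite_set _ _ [set y]); last exact: finite_set1.
  move=> z /= [zx nz]; apply: Ui; rewrite ?inE ?zx //.
  by apply: contrapT => /cindF h; rewrite h eqxx in nz.
apply: (@sub_finite_set _ _ set0); last exact: finite_set0.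
move=> z /= [zx nz]; apply: nU; exists z => //.
by apply: contrapT => /cindF h; rewrite h eqxx in nz.
Qed.

Lemma conv_cind r s U V : set_inj V (dom G) ->
  conv (cind r U) (cind s V) = cind (r * s) (set_mul G U V).
Proof.
move=> Vi; apply/funext => x.
have [[y Vy yx]|nV] := pselect (exists2 y, V y & dom G y = dom G x).
  rewrite (conv_cindr _ _ Vi Vy yx).
  have [Uxy|nUxy] := pselect (U (gmul G x (ginv G y))).
    rewrite !cindT //; exists (gmul G x (ginv G y)), y; split => //.
      by rewrite domMV.
    by rewrite mulgVK.
  rewrite !cindF ?mul0r // => -[z [t [Uz Vt zt xE]]]; apply: nUxy.
  have -> : y = t by apply: Vi; rewrite ?inE // yx xE domM.
  by rewrite xE mulgK.
rewrite conv_cindr0; last by move=> y Vy yx; apply: nV; exists y.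
rewrite cindF // => -[z [t [Uz Vt zt xE]]]; apply: nV.
by exists t => //; rewrite xE domM.
Qed.

Lemma set_mulA U V W :
  set_mul G U (set_mul G V W) = set_mul G (set_mul G U V) W.
Proof.
apply/seteqP; split => x.
  move=> [a [_ [Ua [b [c [Vb Wc bc ->]]] + ->]]].
  rewrite codM // => ab; exists (gmul G a b), c; split => //.
  - by exists a, b.
  - by rewrite domM.
  - by rewrite mulgA.
move=> [_ [c [[a [b [Ua Vb ab ->]]] Wc + ->]]].
rewrite domM // => bc; exists a, (gmul G b c); split => //.
- by exists b, c.
- by rewrite codM.
- by rewrite mulgA.
Qed.

Section SpanRing.
Variables (Gam : zmodType) (kap : T -> Gam) (B : set (set T)).

(* The span of the characteristic functions of the sets in B is a ring under
   convolution as soon as B is a semigroup of sets on which d is injective. *)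
Record conv_family : Prop := ConvFamily {
  cf_inj : forall U, B U -> set_inj U (dom G);
  cf_mul : forall U V, B U -> B V -> B (set_mul G U V);
  cf_deg : forall U, B U -> finite_set (kap @` U);
  cf_comp : forall U gam, B U ->
    U `&` kap @^-1` [set gam] = set0 \/ B (U `&` kap @^-1` [set gam]) }.

Hypothesis kapM : forall x y, dom G x = cod G y ->
  kap (gmul G x y) = kap x + kap y.
Hypothesis hB : conv_family.

Lemma span_fib f : span B f -> fib_finite f.
Proof.
move: f; apply: span_ind => [x|f g _ _ ff fg|r U BU].
- apply: (@sub_finite_set _ _ set0); last exact: finite_set0.
  by move=> y /= [_ /eqP].
- exact: fib_finiteD.
- by apply: fib_finite_cind; apply: cf_inj.
Qed.

Lemma span_conv f g : span B f -> span B g -> span B (conv f g).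
Proof.
move=> sf; move: g; apply: span_ind => [|g h sg sh cg ch|s V BV].
- by rewrite conv0r; apply: span0.
- by rewrite convDr; [apply: spanD | apply: span_fib..].
move: f sf; apply: span_ind => [|g h sg sh cg ch|r U BU].
- by rewrite conv0l; apply: span0.
- by rewrite convDl; [apply: spanD | apply: fib_finite_cind; apply: cf_inj].
rewrite conv_cind; last exact: cf_inj.
by apply: span_cind; apply: cf_mul.
Qed.

Lemma convA f g h : span B f -> span B g -> span B h ->
  conv f (conv g h) = conv (conv f g) h.
Proof.
move=> sf sg; move: h; apply: span_ind => [|h k sh sk ch ck|t W BW].
- by rewrite !conv0r.
- rewrite (convDr _ (span_fib sh) (span_fib sk)) convDr ?ch ?ck.
  + by rewrite convDr //; apply: span_fib.
  + by apply: span_fib; apply: span_conv.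
  + by apply: span_fib; apply: span_conv.
have fW : fib_finite (cind t W) by apply: fib_finite_cind; apply: cf_inj.
move: g sg; apply: span_ind => [|h k sh sk ch ck|s V BV].
- by rewrite conv0l !conv0r conv0l.
- rewrite convDl // convDr ?ch ?ck.
  + by rewrite (convDr _ (span_fib sh) (span_fib sk)) convDl.
  + by apply: span_fib; apply: span_conv => //; apply: span_cind.
  + by apply: span_fib; apply: span_conv => //; apply: span_cind.
have fV : fib_finite (cind s V) by apply: fib_finite_cind; apply: cf_inj.
move: f sf; apply: span_ind => [|h k sh sk ch ck|r U BU].
- by rewrite !conv0l.
- rewrite (convDl h k fV) (convDl (conv h _) _ fW) -ch -ck convDl //.
  by apply: span_fib; apply: span_conv => //; apply: span_cind.
rewrite !conv_cind ?set_mulA ?mulrA //; try by apply: cf_inj.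
by apply: cf_inj => //; apply: cf_mul.
Qed.

Definition span_ring : zmodType := subgroup_of (span_subgroup B).

Lemma span_ringP (a : span_ring) : span B (sub_val a).
Proof. exact: sub_valP. Qed.

Definition span_mul (a b : span_ring) : span_ring :=
  sub_mk (span_subgroup B) (span_conv (span_ringP a) (span_ringP b)).

Definition span_comp (gam : Gam) : set span_ring :=
  [set a | span [set U | B U /\ U `<=` kap @^-1` [set gam]] (sub_val a)].

Lemma span_mulA : associative span_mul.
Proof. by move=> a b c; apply: val_inj; apply: convA; apply: span_ringP. Qed.

Lemma span_mulDl : left_distributive span_mul +%R.
Proof.
move=> a b c; apply: val_inj; apply: convDl; apply: span_fib; exact: span_ringP.
Qed.

Lemma span_mulDr : right_distributive span_mul +%R.
Proof.
by move=> a b c; apply: val_inj; apply: convDr; apply: span_fib; apply: span_ringP.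
Qed.

Lemma span_compM del gam a b :
  span_comp del a -> span_comp gam b -> span_comp (del + gam) (span_mul a b).
Proof.
rewrite /span_comp /=; move: (sub_val a) (sub_val b) => {a b} f g.
set Bd := [set U | _ /\ _ `<=` kap @^-1` [set del]].
set Bg := [set U | _ /\ _ `<=` kap @^-1` [set gam]] => sf sg.
have sB : Bg `<=` B by move=> U [].
move: g sg; apply: span_ind => [|g h sg sh cg ch|s V [BV Vg]].
- by rewrite conv0r; apply: span0.
- rewrite convDr; first exact: spanD.
    by apply: span_fib; apply: span_sub sg.
  by apply: span_fib; apply: span_sub sh.
move: f sf; apply: span_ind => [|g h sg sh cg ch|r U [BU Ud]].
- by rewrite conv0l; apply: span0.
- by rewrite convDl; [apply: spanD | apply: fib_finite_cind; apply: cf_inj].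
rewrite conv_cind; last exact: cf_inj.
apply: span_cind; split; first exact: cf_mul.
by move=> _ [g [h [Ug Vh gh ->]]] /=; rewrite kapM // (Ud g) // (Vg h).
Qed.

Definition restr (gam : Gam) f : T -> R := fun x => if kap x == gam then f x else 0.

Lemma span_restr gam f : span B f ->
  span [set U | B U /\ U `<=` kap @^-1` [set gam]] (restr gam f).
Proof.
move: f; apply: span_ind => [|f g _ _ hf hg|r U BU].
- have -> : restr gam 0 = 0; last exact: span0.
  by apply/funext => x; rewrite /restr; case: ifP.
- have -> : restr gam (f + g) = restr gam f + restr gam g; last exact: spanD.
  apply/funext => x.
  change (restr gam (f + g) x = restr gam f x + restr gam g x).
  by rewrite /restr; case: ifP => // _; rewrite addr0.
have -> : restr gam (cind r U) = cind r (U `&` kap @^-1` [set gam]).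
  apply/funext => x; rewrite /restr; case: eqP => [xg|nx].
    have [Ux|nU] := pselect (U x); first by rewrite !cindT.
    by rewrite !cindF // => -[].
  by rewrite cindF // => -[].
case: (cf_comp hB gam BU) => [->|BUg]; first by rewrite cind0; apply: span0.
by apply: span_cind; split => // x [].
Qed.

Lemma span_restr_finite f : span B f ->
  finite_set [set gam | restr gam f != 0].
Proof.
move: f; apply: span_ind => [|f g _ _ hf hg|r U BU].
- apply: (@sub_finite_set _ _ set0); last exact: finite_set0.
  by move=> gam /= /eqP []; apply/funext => x; rewrite /restr; case: ifP.
- apply: (@sub_finite_set _ _ ([set gam | restr gam f != 0] `|`
     [set gam | restr gam g != 0])); last by rewrite finite_setU.
  move=> gam /= nfg; have [f0|] := eqVneq (restr gam f) 0; last by left.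
  right; apply: contra nfg => /eqP g0; apply/eqP.
  have -> : restr gam (f + g) = restr gam f + restr gam g.
    apply/funext => x.
    change (restr gam (f + g) x = restr gam f x + restr gam g x).
    by rewrite /restr; case: ifP => // _; rewrite addr0.
  by rewrite f0 g0 addr0.
apply: (@sub_finite_set _ _ (kap @` U)); last exact: cf_deg.
move=> gam /= /eqP nz; apply: contrapT => nU; apply: nz.
apply/funext => x; rewrite /restr; case: eqP => // xg.
by rewrite cindF // => Ux; apply: nU; exists x.
Qed.

Lemma span_comp_supp gam (a : span_ring) x :
  span_comp gam a -> kap x <> gam -> sub_val a x = 0.
Proof.
rewrite /span_comp /= => sa nx; move: (sub_val a) sa => f.
move: f; apply: span_ind => [//|f g _ _ hf hg|r U [_ Ug]].
  by change (f x + g x = 0); rewrite hf hg addr0.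
by apply: cindF => /Ug.
Qed.

Lemma span_sum_eval (p : Gam -> span_ring) x :
    finite_set [set gam | p gam != 0] ->
    (forall gam, span_comp gam (p gam)) ->
  sub_val (\sum_(gam \in [set: Gam]) p gam) x = sub_val (p (kap x)) x.
Proof.
move=> fp cp; set S := [set gam | p gam != 0] `|` [set kap x].
have fS : finite_set S by rewrite finite_setU; split.
have -> : \sum_(gam \in [set: Gam]) p gam = \sum_(gam \in S) p gam.
  symmetry; apply: fsbig_widen => // gam [_ nS] /=.
  apply/eqP; apply: contrapT => /negP n0; apply: nS; left; exact: n0.
rewrite fsbig_finite //=.
rewrite (@big_morph _ _ (fun a : span_ring => sub_val a x) 0 +%R 0 +%R) //.
rewrite -(fsbig_finite _ (fun gam => sub_val (p gam) x)) //.
rewrite -(@fsbig_widen _ _ _ _ [set kap x] S) ?fsbig_set1 //.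
- by move=> gam ->; right.
- by move=> gam [_ /= ng]; apply: span_comp_supp (cp gam) _ => e; apply: ng.
Qed.

Lemma span_grading : is_grading span_comp.
Proof.
split=> [gam|a].
  split=> [|a b]; first exact: span0.
  rewrite /span_comp /= => ha hb; apply: spanD => //; exact: spanN.
have sB gam : [set U | B U /\ U `<=` kap @^-1` [set gam]] `<=` B by move=> U [].
pose p gam := sub_mk (span_subgroup B)
  (@span_sub _ _ (sB gam) _ (span_restr gam (span_ringP a))).
have fp : finite_set [set gam | p gam != 0].
  apply: sub_finite_set (span_restr_finite (span_ringP a)) => gam /=.
  by apply: contra => /eqP h; apply/eqP; apply: val_inj.
have cp gam : span_comp gam (p gam) by apply: span_restr; apply: span_ringP.
exists p; split.
  split => //; apply: val_inj; apply/funext => x.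
  by rewrite [RHS]span_sum_eval // /p sub_mkK /restr eqxx.
move=> q [fq cq aE]; apply/funext => gam; apply: val_inj; apply/funext => x.
have [e|/eqP ne] := eqVneq (kap x) gam.
  rewrite /= /restr e eqxx [in LHS]aE -e.
  exact: span_sum_eval.
rewrite [RHS](span_comp_supp (cq gam)) //.
by apply: (span_comp_supp (cp gam)).
Qed.

Definition span_graded : gradedRing Gam :=
  GradedRing span_mulA span_mulDl span_mulDr span_grading span_compM.

End SpanRing.
End Convolution.

Lemma open_map_homeo (X : topologicalType) (U : set X) (f : X -> X) :
    open U -> set_inj U f -> continuous f ->
    (forall O, open O -> open (f @` O)) ->
  homeo_onto U f (f @` U).
Proof.
move=> oU fi fc fo.
have [h hP] : {h : X -> X & forall y, (f @` U) y -> U (h y) /\ f (h y) = y}.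
  apply: (@choice _ _ (fun y x => (f @` U) y -> U x /\ f x = y)) => y.
  have [[x Ux fx]|n] := pselect ((f @` U) y); first by exists x.
  by exists y => /n.
split; [by split | exact: continuous_subspaceT |].
have hK x : U x -> h (f x) = x.
  move=> Ux; have [Uh e] := hP (f x) (imageP f Ux).
  by apply: fi; rewrite ?inE.
exists h => //; apply/continuous_in_subspaceT/continuous_inP; first exact: fo.
move=> O oO; rewrite (_ : _ `&` _ = f @` (U `&` O)).
  by apply: fo; apply: openI.
apply/seteqP; split => [y [[x Ux <-]]|_ [x [Ux Ox] <-]].
  by rewrite /preimage /= hK // => Ox; exists x.
by split; [exists x | rewrite /preimage /= hK].
Qed.

Lemma within_open_in (X Y : topologicalType) (A : set X) (f : X -> Y) :
  open A -> {within A, continuous f} -> {in A, continuous f}.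
Proof. by move=> /continuous_open_subspace ->. Qed.

Section AmpleTheory.
Variables (T : topologicalType) (G : groupoid T).
Hypotheses (tG : topological_groupoid G) (aG : ample G).

Lemma ginv_continuous : continuous (ginv G). Proof. by case: tG. Qed.

Lemma gmul_continuous_within (X : topologicalType) (A : set X) (a b : X -> T) :
    (forall x, A x -> dom G (a x) = cod G (b x)) ->
    {within A, continuous a} -> {within A, continuous b} ->
  {within A, continuous (fun x => gmul G (a x) (b x))}.
Proof.
move=> ab /subspace_continuousP ca /subspace_continuousP cb.
case: tG => _ /subspace_continuousP cm.
apply/subspace_continuousP => x Ax.
have cab : (a z, b z) @[z --> within A (nbhs x)] -->
    within (composable G) (nbhs (a x, b x)).
  move=> /= Q; rewrite /within /= => hQ.
  have hp : (a z, b z) @[z --> within A (nbhs x)] --> (a x, b x).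
    by apply: cvg_pair; [apply: ca | apply: cb].
  have := hp _ hQ; rewrite /nbhs /= /within /=.
  by apply: filterS => z hz Az; apply: hz => //; apply: ab.
exact: (cvg_comp _ _ cab (cm (a x, b x) (ab x Ax))).
Qed.

Lemma dom_continuous : continuous (dom G).
Proof.
apply/continuous_subspace_setT; apply: gmul_continuous_within.
- by move=> x _; apply: domV.
- by apply: continuous_subspaceT; apply: ginv_continuous.
- by apply: continuous_subspaceT => x.
Qed.

Lemma codE : cod G = dom G \o ginv G.
Proof. by apply/funext => g /=; rewrite domV. Qed.

Lemma cod_continuous : continuous (cod G).
Proof.
rewrite codE => x; apply: continuous_comp; first exact: ginv_continuous.
exact: dom_continuous.
Qed.

Lemma open_units : open (units G).
Proof.
rewrite openE => x xu; have [loc _ _] := aG.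
have [W [oW Wx [V [_ _ [[_ Wi _] _ _]]]]] := loc x.
have Wdx : W (dom G x) by rewrite [dom G x]xu.
have nW : nbhs x (W `&` dom G @^-1` W).
  apply: filterI; first exact: open_nbhs_nbhs.
  by apply: dom_continuous; apply: open_nbhs_nbhs.
apply: filterS nW => y [Wy Wdy]; apply: Wi; rewrite ?inE //.
exact: dom_dom.
Qed.

Lemma open_rel_units (V : set T) :
  V `<=` units G -> open (V : set (subspace (units G))) -> open V.
Proof.
by move=> Vu oV; rewrite -(setIidl Vu) open_setIS //; apply: open_units.
Qed.

Lemma dom_open_map (O : set T) : open O -> open (dom G @` O).
Proof.
move=> oO; rewrite openE => _ [g Og <-]; have [loc _ _] := aG.
have [W [oW Wg [V [Vu oV [[Wmap Wi Wsurj] _ [h hK hc]]]]]] := loc g.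
have oV' : open V by apply: open_rel_units.
have oVh : open (V `&` h @^-1` (O `&` W)).
  apply: (iffLR (continuous_inP h oV') _); last exact: openI.
  exact: within_open_in.
have : nbhs (dom G g) (V `&` h @^-1` (O `&` W)).
  apply: open_nbhs_nbhs; split => //; split; first exact: Wmap.
  by rewrite /preimage /= hK.
apply: filterS => y [Vy]; rewrite /preimage /=.
have [z Wz zy] := Wsurj _ Vy; rewrite -zy hK // => -[Oz _].
by exists z.
Qed.

Lemma cod_image (O : set T) : cod G @` O = dom G @` (ginv G @^-1` O).
Proof.
apply/seteqP; split => [_ [g Og <-]|_ [g Og <-]].
  by exists (ginv G g); rewrite ?domV // /preimage /= ginvK.
by exists (ginv G g) => //; rewrite codV.
Qed.

Lemma cod_open_map (O : set T) : open O -> open (cod G @` O).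
Proof.
move=> oO; rewrite cod_image; apply: dom_open_map.
by apply: open_comp => // x _; apply: ginv_continuous.
Qed.

Lemma open_bisectionP (U : set T) : open_bisection G U <->
  [/\ open U, set_inj U (dom G) & set_inj U (cod G)].
Proof.
split=> [[oU [V [_ _ [[_ di _] _ _]]] [V' [_ _ [[_ ci _] _ _]]]] //|[oU di ci]].
split => //.
- exists (dom G @` U); split.
  + by move=> _ [g _ <-]; apply: units_dom.
  + by apply: open_subspaceW; apply: dom_open_map.
  + by apply: open_map_homeo => //; [apply: dom_continuous | apply: dom_open_map].
- exists (cod G @` U); split.
  + by move=> _ [g _ <-]; apply: units_cod.
  + by apply: open_subspaceW; apply: cod_open_map.
  + by apply: open_map_homeo => //; [apply: cod_continuous | apply: cod_open_map].
Qed.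

Lemma compact_closed_units (K : set T) :
  K `<=` units G -> compact K -> forall x, units G x -> ~ K x ->
  exists O, [/\ open O, O x & O `&` K = set0].
Proof.
move=> Ku cK x ux nK; have [_ hG _] := aG.
have hs y : K y -> exists AB : set T * set T,
    [/\ open AB.1, open AB.2, AB.1 x, AB.2 y & AB.1 `&` AB.2 = set0].
  move=> Ky; pose x' : set_type (units G) := exist _ x (mem_set ux).
  pose y' : set_type (units G) := exist _ y (mem_set (Ku _ Ky)).
  have nxy : x' != y' by apply/eqP => -[e]; apply: nK; rewrite e.
  move: (hG); rewrite open_hausdorff => /(_ x' y' nxy).
  move=> [[A B] /= [/set_mem Ax /set_mem By] [[A0 oA AE] [B0 oB BE] /eqP AB]].
  exists (A0 `&` units G, B0 `&` units G) => /=; split.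
  - by apply: openI => //; apply: open_units.
  - by apply: openI => //; apply: open_units.
  - by split => //; move: Ax; rewrite -AE.
  - by split; [move: By; rewrite -BE | exact: (Ku y Ky)].
  - rewrite -subset0 => z [[Az uz] [Bz _]].
    have : (A `&` B) (exist _ z (mem_set uz)) by split; rewrite -?AE -?BE.
    by rewrite AB.
have cov := (iffLR (compact_near_coveringP K) cK).
have := cov T (nbhs x) (fun z y => z <> y) (nbhs_filter x).
have hyp : forall y, K y -> \forall y' \near y & z \near nbhs x, z <> y'.
  move=> y Ky; have [[A B] /= [oA oB Ax By AB]] := hs _ Ky.
  exists (B, A) => /=; first by split; apply: open_nbhs_nbhs.
  move=> [y' z] /= [By' Az] e; have : (A `&` B) z by split => //; rewrite e.
  by rewrite AB.
move=> /(_ hyp); rewrite nbhsE => -[O [oO Ox] OK].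
exists O; split => //; rewrite -subset0 => z [Oz Kz]; exact: (OK z Oz z Kz).
Qed.

Lemma closed_cod_preimage (K : set T) :
  K `<=` units G -> compact K -> closed (cod G @^-1` K).
Proof.
move=> Ku cK; rewrite -openC openE => g nK.
have [O [oO Oc OK]] := compact_closed_units Ku cK (units_cod G g) nK.
have : nbhs g (cod G @^-1` O) by apply: cod_continuous; apply: open_nbhs_nbhs.
apply: filterS => h Oh Kh; have : (O `&` K) (cod G h) by [].
by rewrite OK.
Qed.

Lemma compact_open_bisection_mul (U V : set T) :
    compact_open_bisection G U -> compact_open_bisection G V ->
  compact_open_bisection G (set_mul G U V).
Proof.
move=> [cU bU] [cV bV].
have [oU [V1 [V1u oV1 [[U1 dU U2] Uc [s sK sc]]]] _] := bU.
have [oV [V2 [V2u oV2 [[V21 dV V22] Vc [t tK tc]]]] _] := bV.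
move/open_bisectionP: (bU) => [_ _ ciU].
move/open_bisectionP: (bV) => [_ _ ciV].
have E1 : V1 = dom G @` U.
  by apply/seteqP; split => [y /U2 //|_ [g Ug <-]]; apply: U1.
have E2 : V2 = dom G @` V.
  by apply/seteqP; split => [y /V22 //|_ [g Ug <-]]; apply: V21.
have cV1 : compact V1.
  by rewrite E1; apply: continuous_compact => //; apply: continuous_subspaceT;
    apply: dom_continuous.
split.
  pose K := V `&` cod G @^-1` V1.
  have cK : compact K by apply: compact_closedI => //; apply: closed_cod_preimage.
  have -> : set_mul G U V = (fun h => gmul G (s (cod G h)) h) @` K.
    apply/seteqP; split => [_ [g [h [Ug Vh gh ->]]]|_ [h [Vh V1h] <-]].
      exists h; first by split => //; rewrite /preimage /= -gh; apply: U1.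
      by rewrite -gh sK.
    have [g Ug gE] := U2 _ V1h; exists g, h; split => //.
    by rewrite -[cod G h]gE sK.
  apply: continuous_compact => //; apply: gmul_continuous_within.
  - move=> h [Vh V1h]; have [g Ug gE] := U2 _ V1h.
    by rewrite -[in LHS]gE sK.
  - apply: (@within_continuous_comp _ _ _ K (cod G) s).
      move=> _ /set_mem [h [Vh V1h] <-].
      by apply: (within_open_in _ sc); rewrite ?inE //; apply: open_rel_units.
    by apply: continuous_subspaceT; apply: cod_continuous.
  - by apply: continuous_subspaceT => x.
apply/open_bisectionP; split.
- pose D := dom G @^-1` V2.
  have oV2' : open V2 by apply: open_rel_units.
  have oD : open D by apply: open_comp => // x _; apply: dom_continuous.
  have -> : set_mul G U V =
      D `&` (fun k => gmul G k (ginv G (t (dom G k)))) @^-1` U.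
    apply/seteqP; split => [_ [g [h [Ug Vh gh ->]]]|k [Vk Uk]].
      split; first by rewrite /D /preimage /= domM //; apply: V21.
      by rewrite /preimage /= domM // tK // mulgK.
    move: Uk; have [h Vh hk] := V22 _ Vk.
    rewrite /preimage /= -hk tK // => Uk.
    by exists (gmul G k (ginv G h)), h; split; rewrite ?domMV ?mulgVK.
  apply: (iffLR (continuous_inP _ oD) _) => //; apply: within_open_in => //.
  apply: gmul_continuous_within.
  + by move=> x /V22 [h Vh hx]; rewrite codV -[in RHS]hx tK.
  + by apply: continuous_subspaceT => x.
  + apply: (@within_continuous_comp _ _ _ D (t \o dom G) (ginv G)).
      by move=> *; apply: ginv_continuous.
    apply: (@within_continuous_comp _ _ _ D (dom G) t).
      move=> _ /set_mem [h Dh <-].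
      by apply: (within_open_in oV2' tc); rewrite ?inE.
    by apply: continuous_subspaceT; apply: dom_continuous.
- move=> x y /set_mem [g [h [Ug Vh gh ->]]] /set_mem [g' [h' [Ug' Vh' gh' ->]]].
  rewrite !domM // => e; have eh : h = h' by apply: dV; rewrite ?inE.
  by rewrite eh; congr gmul; apply: dU; rewrite ?inE // gh gh' eh.
- move=> x y /set_mem [g [h [Ug Vh gh ->]]] /set_mem [g' [h' [Ug' Vh' gh' ->]]].
  rewrite !codM // => e; have eg : g = g' by apply: ciU; rewrite ?inE.
  by rewrite eg; congr gmul; apply: ciV; rewrite ?inE // -gh -gh' eg.
Qed.

Lemma compact_open_units_bisection (U : set T) :
  compact_open_units G U -> compact_open_bisection G U.
Proof.
move=> [Uu cU oU]; split => //; apply/open_bisectionP; split.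
- exact: open_rel_units.
- by move=> x y /set_mem/Uu <- /set_mem/Uu <-; rewrite !dom_dom.
- move=> x y /set_mem/Uu ux /set_mem/Uu uy.
  by rewrite !unit_cod.
Qed.

End AmpleTheory.

Section SteinbergAlgebra.
Variables (R : comPzRingType) (Gam : zmodType) (G : gradedAmpleGroupoid Gam).

Lemma deg_clopen (gam : Gam) : open (deg G @^-1` [set gam]) /\
  closed (deg G @^-1` [set gam]).
Proof.
split.
  apply: (@open_comp _ _ (deg G : G -> discrete_topology Gam)).
    by move=> x _; apply: deg_continuous.
  exact: (@discrete_open (discrete_topology Gam)).
apply: (@preimage_closed _ _ (deg G : G -> discrete_topology Gam)).
  by move=> x _; apply: deg_continuous.
exact: (@discrete_closed (discrete_topology Gam)).
Qed.

Lemma compact_deg_finite (U : set G) : compact U -> finite_set (deg G @` U).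
Proof.
move=> cU; pose F : set_system (set Gam) :=
  filter_from [set E : set Gam | finite_set E]
    (fun E => [set E' | finite_set E' /\ E `<=` E']).
have FF : Filter F.
  apply: filter_from_filter; first by exists set0; apply: finite_set0.
  move=> A B fA fB; exists (A `|` B); first by rewrite /= finite_setU.
  by move=> E [fE ABE]; split; split => // x Ax; apply: ABE; [left | right].
have := (iffLR (compact_near_coveringP U) cU) (set Gam) F
  (fun E x => finite_set E /\ E (deg G x)) FF.
have hyp : forall x, U x ->
    \forall x' \near x & E \near F, finite_set E /\ E (deg G x').
  move=> x Ux; exists (deg G @^-1` [set deg G x], [set E | finite_set E /\ E (deg G x)]).
    split => /=; first by apply: open_nbhs_nbhs; split => //; case: (deg_clopen (deg G x)).
    exists [set deg G x]; first exact: finite_set1.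
    by move=> E [fE h]; split => //; apply: h.
  by move=> [x' E] /= [-> []].
move=> /(_ hyp) [E fE hE].
apply: (@sub_finite_set _ _ E) => // _ [x Ux <-].
by have [] := hE E (conj fE (fun _ h => h)) x Ux.
Qed.

Lemma bisection_family :
  conv_family G (deg G) (compact_open_bisection G).
Proof.
have [tG aG] := (arrows_top G, arrows_ample G).
split.
- by move=> U [_ /(open_bisectionP tG aG) []].
- exact: compact_open_bisection_mul.
- by move=> U [cU _]; apply: compact_deg_finite.
- move=> U gam [cU /(open_bisectionP tG aG) [oU dU cUi]]; right.
  have [od cd] := deg_clopen gam.
  split; first exact: compact_closedI.
  apply/(open_bisectionP tG aG); split; first exact: openI.
    by move=> x y /set_mem [Ux _] /set_mem [Uy _]; apply: dU; rewrite inE.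
  by move=> x y /set_mem [Ux _] /set_mem [Uy _]; apply: cUi; rewrite inE.
Qed.

Definition steinberg : gradedRing Gam :=
  span_graded R (@degM Gam G) bisection_family.

Definition steinberg_cind (r : R) (U : set G)
    (hU : compact_open_bisection G U) : steinberg :=
  sub_mk (span_subgroup R (compact_open_bisection G)) (span_cind r hU).

Definition steinberg_cind_units (r : R) (U : set G)
    (hU : compact_open_units G U) : steinberg :=
  steinberg_cind r (compact_open_units_bisection (arrows_top G) (arrows_ample G) hU).

Variable x : G.

Definition isotropy_points : set (set G) :=
  [set U | exists2 t, isotropy G x t & U = [set t]].

Lemma isotropy_family : conv_family G (deg G) isotropy_points.
Proof.
split.
- by move=> _ [t _ ->] a b /set_mem -> /set_mem ->.
- move=> _ _ [t [dt ct] ->] [u [du cu] ->]; exists (gmul G t u).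
    by split; rewrite ?domM ?codM // dt cu.
  apply/seteqP; split => [_ [_ [_ [-> -> _ ->]]] //|_ ->].
  by exists t, u; split => //; rewrite dt cu.
- by move=> _ [t _ ->]; rewrite image_set1; apply: finite_set1.
- move=> _ gam [t ht ->]; have [e|ne] := pselect (deg G t = gam).
    right; exists t => //; apply/seteqP; split => [y [] //|y ->]; by split.
  by left; rewrite -subset0 => y [-> /= /ne].
Qed.

(* The group ring R G_x: its elements are the finitely supported functions on
   G_x, extended by 0 to G, and the convolution of G restricts to its product
   (see isotropy_cindM). *)
Definition isotropy_ring : gradedRing Gam :=
  span_graded R (@degM Gam G) isotropy_family.

Definition isotropy_cind (r : R) (t : G) (ht : isotropy G x t) : isotropy_ring :=
  sub_mk (span_subgroup R isotropy_points)
    (span_cind r (ex_intro2 _ _ t ht erefl)).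

Lemma isotropyM (t u : G) :
  isotropy G x t -> isotropy G x u -> isotropy G x (gmul G t u).
Proof. by move=> [dt ct] [du cu]; split; rewrite ?domM ?codM // dt cu. Qed.

Lemma isotropy_cindM (r s : R) (t u : G) (ht : isotropy G x t)
    (hu : isotropy G x u) :
  rmul (isotropy_cind r ht) (isotropy_cind s hu) =
  isotropy_cind (r * s) (isotropyM ht hu).
Proof.
apply: val_inj => /=; rewrite conv_cind; last by move=> a b /set_mem -> /set_mem ->.
congr cind; apply/seteqP; split => [_ [_ [_ [-> -> _ ->]]] //|_ ->].
by exists t, u; split => //; case: ht hu => -> _ [_ ->].
Qed.

End SteinbergAlgebra.

Section Restriction.
Variables (R : comPzRingType) (Gam : zmodType) (G : gradedAmpleGroupoid Gam).
Variables (x : G) (M : gradedModule (steinberg R G)).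

Definition res : set M := [set w |
  forall (U : set G) (hU : compact_open_units G U), U x ->
    exists m : M, act M (steinberg_cind_units 1 hU) m = w].

Lemma res_subgroup : is_subgroup res.
Proof.
split=> [U hU Ux|v w hv hw U hU Ux].
  exists 0; apply: (@addrI _ (act M (steinberg_cind_units 1 hU) 0)).
  by rewrite -actDr !addr0.
have [[m <-] [n <-]] := (hv U hU Ux, hw U hU Ux).
exists (m - n); apply: (@addIr _ (act M (steinberg_cind_units 1 hU) n)).
by rewrite -actDr !subrK.
Qed.

Definition res_group : zmodType := subgroup_of res_subgroup.

End Restriction.

(* Main.v *)
(* An element f of the Steinberg algebra acts on Res_x(M) only through its values
   on the fibre d^-1(x): if f vanishes there, then f 1_U = 0 for some compact open
   U containing x, and 1_U fixes Res_x(M). So a in R G_x acts as any f that agrees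
   with a on the fibre; such f exist, can be chosen of the same degree as a, and
   are compatible with products because a vanishes outside the isotropy group.
   The homogeneous components of w in Res_x(M) stay in Res_x(M) because 1_U has
   degree 0, so that 1_U w = w holds in every degree. *)
Require Import Defs.
From mathcomp Require Import all_boot ssralg classical_sets topology.
From mathcomp Require Import boolp functions cardinality fsbigop.

Set Implicit Arguments.
Unset Strict Implicit.
Unset Printing Implicit Defensive.

Import GRing.Theory.

Local Open Scope classical_set_scope.
Local Open Scope ring_scope.

(** * Additive maps and finitely supported sums *)

Lemma additive_fsum (I : choiceType) (V W : zmodType) (phi : V -> W) (p : I -> V) :
    phi 0 = 0 -> {morph phi : v w / v + w} ->
    finite_set [set i | p i != 0] ->
  phi (\sum_(i \in [set: I]) p i) = \sum_(i \in [set: I]) phi (p i).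
Proof.
move=> phi0 phiD fp; pose S := [set i | p i != 0].
have p0 i : ~ S i -> p i = 0 by move=> /negP/negPn/eqP.
rewrite -(@fsbig_widen _ _ _ _ S) //; last by move=> i [_ /p0].
rewrite -(@fsbig_widen _ _ _ _ S [set: I] (phi \o p)) //.
  by rewrite !fsbig_finite //= (big_morph phi phiD phi0).
by move=> i [_ /p0]; rewrite /preimage /= => ->.
Qed.

Section GradedModule.
Variables (Gam : zmodType) (A : gradedRing Gam) (V : zmodType) (M : gmodule A V).

Lemma act0l v : act M 0 v = 0.
Proof. by apply: (@addIr _ (act M 0 v)); rewrite -actDl !add0r. Qed.

Lemma act0r a : act M a 0 = 0.
Proof. by apply: (@addIr _ (act M a 0)); rewrite -actDr !add0r. Qed.

End GradedModule.

(** * Convolution with sets of units; transfer of extensions from sets to spans *)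

Section Convolution.
Variables (T : choiceType) (G : groupoid T) (R : comPzRingType).
Implicit Types (f h : T -> R) (U : set T).

(** A term is nonzero only if [g y^-1] lies in [U], hence is a unit; this forces [y = g], and the
    sum collapses to one term. *)
Lemma conv_units_l U f g : U `<=` units G ->
  conv G (cind 1 U) f g = cind 1 U (cod G g) * f g.
Proof.
move=> Uu; rewrite /conv -(@fsbig_widen _ _ _ _ [set g]) ?fsbig_set1 //.
  by move=> y ->.
move=> y [/= yg ny]; rewrite cindF ?mul0r // => /Uu; rewrite /units /=.
rewrite domMV // => e; apply: ny => /=.
by rewrite -[RHS](Defs.mulgVK (esym yg)) -e mulcg.
Qed.

Lemma conv_units_r U f g : U `<=` units G ->
  conv G f (cind 1 U) g = f g * cind 1 U (dom G g).
Proof.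
move=> Uu; have Ui : set_inj U (dom G).
  by move=> y z /set_mem/Uu <- /set_mem/Uu <-; rewrite !dom_dom.
have [Ug|nU] := pselect (U (dom G g)).
  rewrite (conv_cindr _ _ _ Ug) ?dom_dom // cindT //.
  by have := Defs.mulgK (esym (cod_dom G g)); rewrite mulgd => ->.
rewrite cindF // mulr0 conv_cindr0 // => y Uy e; apply: nU.
by rewrite -e (Uu y).
Qed.

(** Used with [D] the fibre over [x], [B] made of points of the isotropy group and [C] of compact
    open bisections, possibly inside one degree. *)
Lemma span_extend (D : set T) (B C : set (set T)) :
    (forall U, B U -> exists2 V, C V & forall g, D g -> V g <-> U g) ->
  forall f, span B f ->
    exists2 h : T -> R, span C h & forall g, D g -> h g = f g.
Proof.
move=> BC; apply: span_ind => [|f1 f2 _ _ [h1 s1 e1] [h2 s2 e2]|r U /BC[V CV VU]].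
- by exists 0 => //; exact: span0.
- exists (h1 + h2); first exact: spanD.
  by move=> g Dg; change (h1 g + h2 g = f1 g + f2 g); rewrite e1 ?e2.
- exists (cind r V); first exact: span_cind.
  move=> g Dg; have [Ug|nU] := pselect (U g).
    by rewrite !cindT //; apply/VU.
  by rewrite !cindF // => /VU-/(_ Dg).
Qed.

End Convolution.

(** * The Steinberg algebra near the fibre over [x] *)

Section Fibre.
Variables (R : comPzRingType) (Gam : zmodType) (G : gradedAmpleGroupoid Gam).
Variable x : G.
Hypothesis hx : units G x.

Let tG := arrows_top G.
Let aG := arrows_ample G.

Lemma ample_basis (W : set G) g : open W -> W g ->
  exists U, [/\ compact_open_bisection G U, U g & U `<=` W].
Proof. by case: aG => _ _; apply. Qed.

Lemma ample_unit_basis (O : set G) : open O -> O x ->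
  exists U, [/\ compact_open_units G U, U x & U `<=` O].
Proof.
move=> oO Ox; have oW : open (O `&` units G).
  by apply: openI => //; apply: open_units.
have [U [[cU [oU _ _]] Ux UW]] := ample_basis oW (conj Ox hx).
exists U; split => //; last by move=> y /UW [].
by split => //; [move=> y /UW [] | exact: open_subspaceW].
Qed.

Lemma compact_open_bisection_inj (U : set G) g h : compact_open_bisection G U ->
  U g -> U h -> dom G g = dom G h -> g = h.
Proof.
by move=> [_ /(open_bisectionP tG aG) [_ dU _]] Ug Uh; apply: dU; rewrite inE.
Qed.

(* Near the fibre, f is determined by its values on it: with a bisection N g
   fixed for each g, the right-hand side is linear in f, and for f = 1_U it
   involves only the germ of U at its point over x. *)
Lemma fibre_germ (N : G -> set G) :
    (forall g, compact_open_bisection G (N g) /\ N g g) ->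
  forall f : G -> R, span (compact_open_bisection G) f ->
  exists O, [/\ open O, O x & forall y, O (dom G y) ->
    f y = \sum_(g \in [set g | dom G g = x]) cind 1 (N g) y * f g].
Proof.
move=> hN; have xd : dom G x = x by [].
apply: span_ind => [|f1 f2 s1 s2 [O1 [oO1 O1x e1]] [O2 [oO2 O2x e2]]|r U hU].
- exists setT; split => //; first exact: openT.
  by move=> y _; symmetry; apply: fsbig1 => g _; rewrite [(0 : G -> R) g]/0 mulr0.
- exists (O1 `&` O2); split => //; first exact: openI.
  move=> y [/e1 E1 /e2 E2]; change (f1 y + f2 y =
    \sum_(g \in [set g | dom G g = x]) cind 1 (N g) y * (f1 g + f2 g)).
  pose S := [set g | dom G g = dom G x /\ f1 g != 0] `|`
            [set g | dom G g = dom G x /\ f2 g != 0].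
  have fS : finite_set S.
    by rewrite finite_setU; split; apply: (span_fib (bisection_family G)).
  have Sd : S `<=` [set g | dom G g = x] by move=> g; rewrite /S xd => -[[]|[]].
  have S0 g : dom G g = x -> ~ S g -> f1 g = 0 /\ f2 g = 0.
    move=> gx nS; split; apply/eqP; apply: contrapT => /negP n0; apply: nS.
      by left; rewrite xd.
    by right; rewrite xd.
  have wS (F : G -> R) : (forall g, dom G g = x -> ~ S g -> F g = 0) ->
      \sum_(g \in [set g | dom G g = x]) F g = \sum_(g \in S) F g.
    by move=> F0; symmetry; apply: fsbig_widen => // g [/= gx /(F0 g gx)].
  rewrite E1 E2 !wS //; first last.
  - by move=> g gx /(S0 g gx) [-> _]; rewrite mulr0.
  - by move=> g gx /(S0 g gx) [_ ->]; rewrite mulr0.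
  - by move=> g gx /(S0 g gx) [-> ->]; rewrite addr0 mulr0.
  by rewrite -fsbig_split //=; apply: eq_fsbigr => g _; rewrite -mulrDr.
have [[g Ug gx]|nU] := pselect (exists2 g, U g & dom G g = x).
  have [[_ [oN _ _]] Ng] := hN g; have [_ [oU _ _]] := hU.
  (* Over this neighbourhood each [y] shares its domain with some [z] in both [U] and [N g].
     Injectivity of [d] on each bisection then makes [y] in [U] equivalent to [y] in [N g]. *)
  exists (dom G @` (U `&` N g)); split.
  + by apply: dom_open_map => //; apply: openI.
  + by exists g.
  move=> y [z [Uz Nz] zy]; rewrite -(@fsbig_widen _ _ _ _ [set g]) ?fsbig_set1.
  + have [Uy|nUy] := pselect (U y).
      have <- : z = y by apply: (compact_open_bisection_inj hU).
      by rewrite !cindT // mul1r.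
    rewrite cindF // cindF ?mul0r // => Ny; apply: nUy.
    suff <- : z = y by [].
    by have [hNg _] := hN g; apply: (compact_open_bisection_inj hNg).
  + by move=> h ->.
  + move=> h [/= hxx nh]; rewrite /preimage /= [cind r U h]cindF ?mulr0 // => Uh.
    apply: nh.
    by apply: (compact_open_bisection_inj hU); rewrite ?gx.
(* Here [U] misses the fibre: [d(U)] is compact and avoids [x], so the Hausdorff unit space yields a
   neighbourhood of [x] over which [f] is zero. *)
have cdU : compact (dom G @` U).
  case: (hU) => cU _; apply: continuous_compact => //.
  by apply: continuous_subspaceT; apply: dom_continuous.
have dUu : dom G @` U `<=` units G by move=> _ [g _ <-]; apply: units_dom.
have ndU : ~ (dom G @` U) x by move=> [g Ug gx]; apply: nU; exists g.
have [O [oO Ox OU]] := compact_closed_units tG aG dUu cdU hx ndU.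
exists O; split => // y Oy; rewrite cindF; last first.
  by move=> Uy; suff : (O `&` (dom G @` U)) (dom G y) by rewrite OU.
symmetry; apply: fsbig1 => g /= gx; rewrite [cind r U g]cindF ?mulr0 // => Ug.
by apply: nU; exists g.
Qed.

(** Every term of the germ formula vanishes, so [f] is zero over a neighbourhood of [x]; right
    multiplication by [1_U], with [U] inside it, kills all other values. *)
Lemma conv_fibre0 (f : G -> R) : span (compact_open_bisection G) f ->
    (forall g, dom G g = x -> f g = 0) ->
  exists U, [/\ compact_open_units G U, U x & conv G f (cind 1 U) = 0].
Proof.
move=> sf f0; have [N hN] : {N : G -> set G &
    forall g, compact_open_bisection G (N g) /\ N g g}.
  apply: (@choice _ _ (fun g U => compact_open_bisection G U /\ U g)) => g.
  by have [U [hU Ug _]] := ample_basis (@openT G) (I : setT g); exists U.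
have [O [oO Ox fO]] := fibre_germ hN sf.
have [U [hU Ux UO]] := ample_unit_basis oO Ox; exists U; split => //.
have [Uu _ _] := hU; apply/funext => g; rewrite conv_units_r //.
have [Ug|nU] := pselect (U (dom G g)); last by rewrite cindF // mulr0.
rewrite (fO g (UO _ Ug)) fsbig1 ?mul0r // => h /= /f0 ->.
by rewrite mulr0.
Qed.

(** * Extending elements of the isotropy group ring *)

(** As [a] is zero off the isotropy group, this also forces [f] to vanish on arrows from [x] to
    other units. *)
Definition extends (a : isotropy_ring R x) (f : steinberg R G) : Prop :=
  forall g : G, dom G g = x -> sub_val f g = sub_val a g.

Lemma isotropy_ring_supp (a : isotropy_ring R x) (g : G) :
  cod G g <> x -> sub_val a g = 0.
Proof.
move=> ng; move: (sub_val a) (sub_valP a) => f.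
move: f; apply: span_ind => [//|f1 f2 _ _ e1 e2|r _ [t [_ tx] ->]].
  by change (f1 g + f2 g = 0); rewrite e1 e2 addr0.
by apply: cindF => /= e; apply: ng; rewrite e.
Qed.

Lemma extendsD a b f h : extends a f -> extends b h -> extends (a + b) (f + h).
Proof.
move=> af bh g gx; change (sub_val f g + sub_val h g = sub_val a g + sub_val b g).
by rewrite af ?bh.
Qed.

(** The sum at [g] runs over [y] in the fibre, where [h] equals [b]. If [b y] is nonzero then
    [c(y) = x], so [g y^-1] is again in the fibre and [f] may be replaced by [a]. *)
Lemma extendsM a b f h : extends a f -> extends b h ->
  extends (rmul a b) (rmul f h).
Proof.
move=> af bh g gx.
change (conv G (sub_val f) (sub_val h) g = conv G (sub_val a) (sub_val b) g).
apply: eq_fsbigr => y /set_mem /= yg; rewrite bh ?yg //.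
have [yx|ny] := pselect (cod G y = x); last by rewrite isotropy_ring_supp ?mulr0.
by rewrite af // domMV.
Qed.

(** As [d] is injective on [V], the only arrow of [V] over [x] is [t]. *)
Lemma extends_cind r t (ht : isotropy G x t) V (hV : compact_open_bisection G V) :
  V t -> extends (isotropy_cind r ht) (steinberg_cind r hV).
Proof.
move=> Vt g gx; change (cind r V g = cind r [set t] g).
have [->|gt] := pselect (g = t); first by rewrite !cindT.
rewrite !cindF // => Vg; apply: gt.
by apply: (compact_open_bisection_inj hV) => //; rewrite gx; case: ht.
Qed.

(** On the fibre, left multiplication by [1_U] scales the value at [g] by [1_U(c(g))]; this factor
    is 1 wherever [a] can be nonzero, since there [c(g) = x]. *)
Lemma extends_units_mul a f U (hU : compact_open_units G U) : U x ->
  extends a f -> extends a (rmul (steinberg_cind_units 1 hU) f).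
Proof.
move=> Ux af g gx; change (conv G (cind 1 U) (sub_val f) g = sub_val a g).
have [Uu _ _] := hU; rewrite conv_units_l // af //.
have [gx'|ng] := pselect (cod G g = x); first by rewrite gx' cindT // mul1r.
by rewrite isotropy_ring_supp ?mulr0.
Qed.

(** Feeds [span_extend]: [W] is the open set of arrows of a given degree, or all of [G]. *)
Lemma isotropy_bisection (W U : set G) : open W ->
    isotropy_points x U -> U `<=` W ->
  exists2 V, compact_open_bisection G V /\ V `<=` W &
    forall g, dom G g = x -> V g <-> U g.
Proof.
move=> oW [t [tx _] ->] tW; have [V [hV Vt VW]] := ample_basis oW (tW t erefl).
exists V => // g gx; split=> [Vg|->//].
by apply: (compact_open_bisection_inj hV) => //; rewrite gx.
Qed.

Lemma homogeneous_extension del (a : isotropy_ring R x) : rcomp del a ->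
  exists2 f : steinberg R G, rcomp del f & extends a f.
Proof.
have [od _] := deg_clopen G del.
have hB U : isotropy_points x U /\ U `<=` deg G @^-1` [set del] ->
    exists2 V, compact_open_bisection G V /\ V `<=` deg G @^-1` [set del] &
      forall g, dom G g = x -> V g <-> U g.
  by move=> [xU Ud]; apply: isotropy_bisection.
move=> /(span_extend hB) [h sh ha].
have sB : [set V | compact_open_bisection G V /\ V `<=` deg G @^-1` [set del]]
  `<=` compact_open_bisection G by move=> V [].
by exists (sub_mk (span_subgroup R _) (span_sub sB sh)).
Qed.

Lemma extension_exists (a : isotropy_ring R x) : exists f, extends a f.
Proof.
have hB U : isotropy_points x U -> exists2 V, compact_open_bisection G V &
    forall g, dom G g = x -> V g <-> U g.
  move=> /(isotropy_bisection (@openT G))-/(_ (fun _ _ => I)) [V [hV _]].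
  by exists V.
have [h sh ha] := span_extend hB (sub_valP a).
by exists (sub_mk (span_subgroup R _) sh).
Qed.

Lemma deg_unit (u : G) : units G u -> deg G u = 0.
Proof.
move=> uu; apply: (@addIr _ (deg G u)); rewrite add0r -degM ?unit_cod //.
by rewrite -{2}(uu : dom G u = u) mulgd.
Qed.

Lemma rcomp_units U (hU : compact_open_units G U) :
  rcomp 0 (steinberg_cind_units 1 hU : steinberg R G).
Proof.
apply: span_cind; split; first exact: (compact_open_units_bisection tG aG hU).
by case: hU => Uu _ _ u /Uu /deg_unit.
Qed.

End Fibre.

(** * The graded module structure on [Res_x(M)] *)

Section Restriction.
Variables (R : comPzRingType) (Gam : zmodType) (G : gradedAmpleGroupoid Gam).
Variable x : G.
Hypothesis hx : units G x.

(** [1_U] is idempotent, hence fixes its image. *)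
Lemma res_units (M : gradedModule (steinberg R G)) (w : M) U
    (hU : compact_open_units G U) :
  res x w -> U x -> act M (steinberg_cind_units 1 hU) w = w.
Proof.
move=> hw Ux; have [m <-] := hw U hU Ux; rewrite -actA; congr (act M _ m).
apply: val_inj; apply/funext => g; have [Uu _ _] := hU.
change (conv G (cind 1 U) (cind 1 U) g = cind (1 : R) U g).
rewrite conv_units_l //; have [Ug|nU] := pselect (U g).
  by rewrite (unit_cod (Uu g Ug)) !cindT // mul1r.
by rewrite [cind 1 U g]cindF // mulr0.
Qed.

(** Some [1_U] satisfies [(f - h) 1_U = 0], and [w] lies in [1_U M]. This makes the action of the
    group ring independent of the chosen extension. *)
Lemma act_fibre (M : gradedModule (steinberg R G)) (f h : steinberg R G) (w : M) :
    (forall g : G, dom G g = x -> sub_val f g = sub_val h g) -> res x w ->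
  act M f w = act M h w.
Proof.
move=> fh hw; rewrite -(subrK h f) actDl -[RHS]add0r; congr (_ + _).
have fh0 g : dom G g = x -> sub_val (f - h) g = 0.
  by move=> gx; change (sub_val f g - sub_val h g = 0); rewrite fh ?subrr.
have [U [hU Ux e]] := conv_fibre0 hx (sub_valP (f - h)) fh0.
have [m <-] := hw U hU Ux; rewrite -actA -[RHS](act0l M m); congr (act M _ m).
exact: val_inj.
Qed.

Section Module.
Variable M : gradedModule (steinberg R G).
Implicit Types (a b : isotropy_ring R x) (v w : res_group x M).

(** Both [f] and [1_U f] extend [a], so they agree on [w]; hence [f w = 1_U (f w)]. *)
Lemma res_act a (f : steinberg R G) (w : M) :
  extends a f -> res x w -> res x (act M f w).
Proof.
move=> af hw U hU Ux; exists (act M f w); rewrite -actA.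
by apply: act_fibre hw => g gx; rewrite (extends_units_mul hU Ux af) ?af.
Qed.

Let lift a : {f | extends a f} := cid (extension_exists a).

(** The extension is an arbitrary choice; by [isotropy_actE] any other gives the same value, so
    later proofs use whichever one suits. *)
Definition isotropy_act a w : res_group x M :=
  sub_mk (res_subgroup x M) (res_act (svalP (lift a)) (sub_valP w)).

Lemma isotropy_actE a f w : extends a f ->
  sub_val (isotropy_act a w) = act M f (sub_val w).
Proof.
move=> af; apply: act_fibre (sub_valP w) => g gx.
by rewrite af //; exact: (svalP (lift a)).
Qed.

Definition res_comp gam : set (res_group x M) := [set w | mcomp M gam (sub_val w)].

Lemma res_component (w : M) (p : Gam -> M) :
    finite_set [set gam | p gam != 0] -> (forall gam, mcomp M gam (p gam)) ->
    w = \sum_(gam \in [set: Gam]) p gam -> res x w ->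
  forall gam, res x (p gam).
Proof.
move=> fp cp wE hw gam U hU Ux; exists (p gam).
have [_ /(_ w) [q [_ qu]]] := mcomp_grading M.
set e := steinberg_cind_units 1 hU.
(* Both [p] and [1_U p] decompose [w = 1_U w] into homogeneous parts, so by uniqueness both equal
   [q], and [1_U] fixes each component. *)
suff /(congr1 (fun h => h gam)) <- : q = fun del => act M e (p del).
  by rewrite (qu p).
apply: qu; split.
- apply: sub_finite_set fp => del /=; apply: contra => /eqP ->.
  by rewrite act0r.
- move=> del; rewrite -[X in mcomp M X]add0r.
  exact: act_mcomp (rcomp_units R hU) (cp del).
- rewrite -(additive_fsum (act0r M e) (actDr M e) fp).
  by rewrite -wE res_units.
Qed.

Lemma res_comp_grading : is_grading res_comp.
Proof.
have [sM uM] := mcomp_grading M; split=> [gam|w].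
  by have [h0 hB] := sM gam; split=> [|v w hv hw]; [exact: h0 | exact: hB].
have [p [[fp cp wE] pu]] := uM (sub_val w).
have hp := res_component fp cp wE (sub_valP w).
exists (fun gam => sub_mk (res_subgroup x M) (hp gam)); split.
  by split => //; apply: sub_val_inj; rewrite additive_fsum.
move=> q [fq cq wq]; apply/funext => gam; apply: sub_val_inj; rewrite sub_mkK.
(* Uniqueness is inherited from [M]: [sub_val] carries [q] to a homogeneous decomposition there. *)
suff -> : p = fun gam => sub_val (q gam) by [].
by apply: pu; split => //; rewrite wq additive_fsum.
Qed.

Lemma isotropy_actDl a b v :
  isotropy_act (a + b) v = isotropy_act a v + isotropy_act b v.
Proof.
apply: sub_val_inj; have [f af] := extension_exists a.
have [h bh] := extension_exists b.
rewrite sub_valD (isotropy_actE _ (extendsD af bh)) actDl.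
by rewrite (isotropy_actE _ af) (isotropy_actE _ bh).
Qed.

Lemma isotropy_actDr a v w :
  isotropy_act a (v + w) = isotropy_act a v + isotropy_act a w.
Proof.
apply: sub_val_inj; have [f af] := extension_exists a.
by rewrite sub_valD !(isotropy_actE _ af) sub_valD actDr.
Qed.

Lemma isotropy_actA a b v :
  isotropy_act (rmul a b) v = isotropy_act a (isotropy_act b v).
Proof.
apply: sub_val_inj; have [f af] := extension_exists a.
have [h bh] := extension_exists b.
rewrite (isotropy_actE _ (extendsM af bh)) actA.
by rewrite (isotropy_actE _ af) (isotropy_actE _ bh).
Qed.

Lemma isotropy_act_unital v :
  exists (n : nat) (a : 'I_n -> isotropy_ring R x) (w : 'I_n -> res_group x M),
    v = \sum_i isotropy_act (a i) (w i).
Proof.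
have [U [hU Ux _]] := ample_unit_basis hx (@openT G) I.
have ix : isotropy G x x by split => //; exact: unit_cod.
(* One term suffices: the identity of the group ring, the basis element at [x], is extended by
   [1_U], which fixes [v]. *)
exists 1%N, (fun=> isotropy_cind 1 ix), (fun=> v); rewrite big_ord1.
pose hU' := compact_open_units_bisection (arrows_top G) (arrows_ample G) hU.
apply: sub_val_inj; rewrite (isotropy_actE _ (extends_cind 1 ix hU' Ux)).
exact: (esym (res_units hU (sub_valP v) Ux)).
Qed.

Lemma isotropy_act_comp del gam a v :
  rcomp del a -> res_comp gam v -> res_comp (del + gam) (isotropy_act a v).
Proof.
move=> /homogeneous_extension [f fd af] hv.
change (mcomp M (del + gam) (sub_val (isotropy_act a v))).
by rewrite (isotropy_actE _ af); apply: act_mcomp.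
Qed.

Definition res_gmodule : gmodule (isotropy_ring R x) (res_group x M) :=
  GModule isotropy_actDl isotropy_actDr isotropy_actA isotropy_act_unital
    res_comp_grading isotropy_act_comp.

End Module.

Definition res_module (M : gradedModule (steinberg R G)) :
  gradedModule (isotropy_ring R x) := GradedModule (res_gmodule M).

(** * Functoriality of restriction *)

Section Functor.
Variables (M N : gradedModule (steinberg R G)) (f : gradedHom M N).

Lemma res_hom (w : M) : res x w -> res x (f w).
Proof.
by move=> hw U hU Ux; have [m <-] := hw U hU Ux; exists (f m); rewrite -ghomZ.
Qed.

Definition res_map (w : res_module M) : res_module N :=
  sub_mk (res_subgroup x N) (res_hom (sub_valP w)).

Lemma res_mapD v w : res_map (v + w) = res_map v + res_map w.
Proof. by apply: sub_val_inj; exact: ghomD. Qed.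

(** One extension [h] of [a] computes the action on both sides, and [f] commutes with [h]. *)
Lemma res_mapZ a w : res_map (act (res_module M) a w) =
  act (res_module N) a (res_map w).
Proof.
apply: sub_val_inj; have [h ah] := extension_exists a.
change (f (sub_val (isotropy_act a w)) = sub_val (isotropy_act a (res_map w))).
by rewrite !(isotropy_actE _ ah) ghomZ.
Qed.

Lemma res_map_comp gam w : mcomp (res_module M) gam w ->
  mcomp (res_module N) gam (res_map w).
Proof. exact: (@ghom_mcomp _ _ _ _ f). Qed.

Definition res_ghom : gradedHom (res_module M) (res_module N) :=
  GradedHom res_mapD res_mapZ res_map_comp.

End Functor.

Lemma res_ghom_id M : res_ghom (ghom_id M) = ghom_id (res_module M).
Proof. by apply: gradedHom_eq => w; exact: sub_val_inj. Qed.

Lemma res_ghom_comp M N P (g : gradedHom N P) (f : gradedHom M N) :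
  res_ghom (ghom_comp g f) = ghom_comp (res_ghom g) (res_ghom f).
Proof. by apply: gradedHom_eq => w; exact: sub_val_inj. Qed.

Definition res_functor : @functor_on (gradedModuleCat (steinberg R G))
    (gradedModuleCat (isotropy_ring R x)) res_module :=
  @FunctorOn (gradedModuleCat (steinberg R G)) (gradedModuleCat (isotropy_ring R x))
    res_module res_ghom res_ghom_id res_ghom_comp.

End Restriction.

Theorem proposition3p5 (R : comPzRingType) (Gam : zmodType)
    (G : gradedAmpleGroupoid Gam) (x : G) (hx : units G x) :
  exists S : forall M : gradedModule (steinberg R G),
      gmodule (isotropy_ring R x) (res_group x M),
    (forall (M : gradedModule (steinberg R G)) (gam : Gam) (w : res_group x M),
        mcomp (S M) gam w <-> mcomp M gam (sub_val w)) /\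
    (forall (M : gradedModule (steinberg R G)) (r : R) (t : G)
        (ht : isotropy G x t) (V : set G) (hV : compact_open_bisection G V),
        V t -> forall w : res_group x M,
          sub_val (act (S M) (isotropy_cind r ht) w) =
          act M (steinberg_cind r hV) (sub_val w)) /\
    exists F : @functor_on (gradedModuleCat (steinberg R G))
                           (gradedModuleCat (isotropy_ring R x))
                           (fun M => GradedModule (S M)),
      forall (M N : gradedModule (steinberg R G)) (f : gradedHom M N)
          (w : res_group x M),
        sub_val ((functor_map F f : gradedHom _ _) w) = f (sub_val w).
Proof.
(* The grading formula holds by definition of [res_comp]; the action formula holds because [r 1_V]
   extends [r t]. *)
exists (@res_gmodule _ _ _ _ hx); split; [by []|split].
  by move=> M r t ht V hV Vt w; apply: isotropy_actE; exact: extends_cind.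
by exists (@res_functor R _ _ _ hx).
Qed.
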